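(* Let $X$ be a complex Hilbert space and let $$H=\begin{pmatrix} A & B\\ C & -A^*\end{pmatrix}$$ be a Hamiltonian operator matrix on $X\times X$. Suppose that $\mathcal{D}(H)=\mathcal{D}(C)\times\mathcal{D}(B)$. Then $JH=(JH)^*$ if one of the following holds: (1) $A$ is $C$-bounded with relative bound $<1$ and $A^*$ is $B$-bounded with relative bound $\leq 1$; (2) $A$ is $C$-bounded with relative bound $\leq 1$ and $A^*$ is $B$-bounded with relative bound $<1$.
   Context: All operators are linear and possibly unbounded; $\mathcal{D}(T)$ denotes the domain of $T$. Block operator matrix: for operators $A,B,C,D$ in $X$, the matrix $H=\begin{pmatrix} A&B\\ C&D\end{pmatrix}$ denotes the operator on $X\times X$ with domain $\mathcal{D}(H)=(\mathcal{D}(A)\cap\mathcal{D}(C))\times(\mathcal{D}(B)\cap\mathcal{D}(D))$ and action $H(x_1,x_2)^t=(Ax_1+Bx_2,\;Cx_1+Dx_2)^t$. Hamiltonian operator matrix: a block operator matrix $H=\begin{pmatrix} A&B\\ C&-A^*\end{pmatrix}$ on $X\times X$, $X$ a complex Hilbert space, where $A,B,C$ are closed densely defined operators in $X$, $B$ and $C$ are self-adjoint, and $H$ is densely defined. $J=\begin{pmatrix}0&I\\-I&0\end{pmatrix}$ on $X\times X$. Relative boundedness: $S$ is $T$-bounded if $\mathcal{D}(T)\subset\mathcal{D}(S)$ and there are $a,b\ge 0$ with $\|Sx\|\le a\|Tx\|+b\|x\|$ for all $x\in\mathcal{D}(T)$; the relative bound is the infimum of all such $a$. *)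

(* Defs.v *)
From HB Require Import structures.
From mathcomp Require Import all_boot all_order all_algebra sesquilinear.
From mathcomp Require Import all_classical all_reals all_analysis.
From mathcomp Require Import complex.
Set Implicit Arguments.
Unset Strict Implicit.
Unset Printing Implicit Defensive.
Import Order.TTheory GRing.Theory Num.Theory.
Import numFieldNormedType.Exports.
Local Open Scope classical_set_scope.
Local Open Scope ring_scope.
Local Open Scope complex_scope.

(* A partial map from V to W. The values of [app] outside [dom] are junk: no
   definition below depends on them. Linearity is the separate predicate
   [is_linear], so that the adjoint is defined for every partial map. *)
Record operator (V W : Type) := Operator {
  dom : set V;
  app :> V -> W
}.

Definition op_eq (V W : Type) (S T : operator V W) : Prop :=
  dom S = dom T /\ forall x, dom S x -> S x = T x.

Definition comp_op (U V W : Type) (S : operator V W) (T : operator U V) :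
    operator U W :=
  Operator [set x | dom T x /\ dom S (T x)] (fun x => S (T x)).

Section Linear.
Variables (K : pzRingType) (V W : lmodType K).

Definition is_linear (T : operator V W) : Prop :=
  [/\ dom T 0,
      forall (a : K) x y, dom T x -> dom T y -> dom T (a *: x + y) &
      forall (a : K) x y, dom T x -> dom T y -> T (a *: x + y) = a *: T x + T y].

Definition opp_op (T : operator V W) : operator V W :=
  Operator (dom T) (fun x => - T x).

Definition zero_op : operator V W := Operator setT (fun=> 0).

Definition id_op : operator V V := Operator setT (fun x => x).

End Linear.

Arguments zero_op {K V W}.
Arguments id_op {K V}.

Definition block_op (K : pzRingType) (V : lmodType K) (A B C D : operator V V) :
    operator (V * V) (V * V) :=
  Operator ((dom A `&` dom C) `*` (dom B `&` dom D))
           (fun x => (A x.1 + B x.2, C x.1 + D x.2)).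

Definition J_op (K : pzRingType) (V : lmodType K) : operator (V * V) (V * V) :=
  block_op zero_op id_op (opp_op id_op) zero_op.
Arguments J_op {K V}.

(* [dot] is an explicit argument because the norm that the library puts on
   X * X is the max norm, which is not induced by an inner product. When
   [dom T] is dense there is at most one z as below for each y, so [xget]
   returns that z. *)
Definition adjoint (K : pzRingType) (V : lmodType K) (dot : V -> V -> K)
    (T : operator V V) : operator V V :=
  let adj y := [set z | forall x, dom T x -> dot (T x) y = dot x z] in
  Operator [set y | adj y !=set0] (fun y => xget 0 (adj y)).

Definition dot_prod (K : pzRingType) (V : lmodType K) (dot : V -> V -> K)
    (x y : V * V) : K :=
  dot x.1 y.1 + dot x.2 y.2.

Definition selfadjoint (K : pzRingType) (V : lmodType K) (dot : V -> V -> K)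
    (T : operator V V) : Prop :=
  op_eq T (adjoint dot T).

Definition densely_defined (V W : topologicalType) (T : operator V W) : Prop :=
  dense (dom T).

Definition closed_op (V W : topologicalType) (T : operator V W) : Prop :=
  closed [set p : V * W | dom T p.1 /\ p.2 = T p.1].

Section RelativeBound.
Variables (R : realType) (X : normedModType R[i]).

(* Norms on X take (real) values in R[i]; [a%:C] embeds a : R in R[i]. *)
Definition rel_bound_pair (S T : operator X X) (a b : R) : Prop :=
  [/\ 0 <= a, 0 <= b &
      forall x, dom T x -> `|S x| <= a%:C * `|T x| + b%:C * `|x|].

Definition rel_bounded (S T : operator X X) : Prop :=
  dom T `<=` dom S /\ exists a b, rel_bound_pair S T a b.

Definition rel_bound (S T : operator X X) : R :=
  inf [set a | exists b, rel_bound_pair S T a b].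

End RelativeBound.

Section Hamiltonian.
Variables (R : realType) (X : normedModType R[i]) (dot : X -> X -> R[i]).

Definition hamiltonian_op (A B C : operator X X) : operator (X * X) (X * X) :=
  block_op A B C (opp_op (adjoint dot A)).

Definition is_hamiltonian (A B C : operator X X) : Prop :=
  [/\ [/\ is_linear A, is_linear B & is_linear C],
      [/\ closed_op A, closed_op B & closed_op C],
      [/\ densely_defined A, densely_defined B & densely_defined C],
      selfadjoint dot B /\ selfadjoint dot C &
      densely_defined (hamiltonian_op A B C)].

End Hamiltonian.

(* Main.v *)
Require Import Defs.
From mathcomp Require Import all_boot all_order all_algebra sesquilinear.
From mathcomp Require Import all_classical all_reals all_analysis.
From mathcomp Require Import complex.
From mathcomp Require Import ring lra.
From HB Require Import structures.
Set Implicit Arguments.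
Unset Strict Implicit.
Unset Printing Implicit Defensive.
Import Order.TTheory GRing.Theory Num.Theory.
Import numFieldNormedType.Exports.
Local Open Scope classical_set_scope.
Local Open Scope ring_scope.
Local Open Scope complex_scope.

(** With M := J H one has M (x, y) = (C x - A^* y, - A x - B y): a symmetric
    operator whose diagonal part diag(C, - B) is self-adjoint and whose
    off-diagonal part is controlled by the diagonal one.  A symmetric operator
    is self-adjoint as soon as M + a and M + conj a are both onto for some
    scalar a ([selfadjoint_of_onto]), so the point is to solve
    (M + i t) (x, y) = (w1, w2) for t = mu and t = - mu, with mu large.

    Self-adjointness of C and B makes C + i t and B - i t bijective
    ([selfadjoint_resolvent]), with |(T + i t) x|^2 = |T x|^2 + t^2 |x|^2.  In
    the unknown v := (C + i t) x, eliminating y turns the system into the single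
    equation v + Q P v = w1 - Q w2, where P := A (C + i t)^-1 and
    Q := A^* (B - i t)^-1.  If c1 and c2 exceed the two relative bounds, then
    |P| <= c1 and |Q| <= c2 once |t| is large, so the equation is solvable when
    c1 * c2 < 1 ([block_shift_onto]).  Only this product matters: if one
    relative bound is < 1 and the other is <= 1, such c1 and c2 exist
    ([subunit_product_gap]), which treats both cases of the theorem at once.
    Working with the product of the bounds replaces the rescaling of the two
    components that would otherwise precede the Kato-Rellich theorem.

    All surjectivity statements come from one principle ([closed_op_onto]): a
    closed operator that is bounded below and whose range has trivial
    orthogonal complement is onto.  It is proved by minimising |w - T x|, which
    is the existence of orthogonal projections in a Hilbert space. *)

(** * Norms with real values *)

Lemma sqr_Re_norm (R : rcfType) (z : R[i]) :
  complex.Re `|z| ^+ 2 = complex.Re z ^+ 2 + complex.Im z ^+ 2.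
Proof. by rewrite normc_def /= sqr_sqrtr // addr_ge0 ?sqr_ge0. Qed.

Lemma sqr_Re_normMr (R : rcfType) (s : R) (z : R[i]) :
  complex.Re `|s%:C * z| ^+ 2
  = s ^+ 2 * (complex.Re z ^+ 2 + complex.Im z ^+ 2).
Proof. by rewrite sqr_Re_norm; case: z => a b /=; ring. Qed.

Lemma Re_conjMr (R : rcfType) (s : R) (z : R[i]) :
  complex.Re ((s%:C * z)^* * z) = s * (complex.Re z ^+ 2 + complex.Im z ^+ 2).
Proof. by case: z => a b /=; ring. Qed.

Section RealNorm.
Variables (R : realType) (X : normedModType R[i]).
Implicit Types x y : X.

(** The norm of X takes its values in R[i], where the order is only partial;
    its real part lives in an ordered field, where [lra] and [nra] apply. *)
Definition rnorm x : R := complex.Re `|x|.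

Lemma rnormE x : (rnorm x)%:C = `|x|.
Proof. by rewrite RRe_real // ger0_real. Qed.

Lemma rnorm_ge0 x : 0 <= rnorm x.
Proof. by rewrite -ler0c rnormE. Qed.

Lemma rnorm0 : rnorm 0 = 0.
Proof. by apply: complexI; rewrite rnormE normr0. Qed.

Lemma rnorm0_eq0 x : rnorm x = 0 -> x = 0.
Proof. by move=> x0; apply/eqP; rewrite -normr_eq0 -rnormE x0. Qed.

Lemma rnormN x : rnorm (- x) = rnorm x.
Proof. by rewrite /rnorm normrN. Qed.

Lemma rnorm_distC x y : rnorm (x - y) = rnorm (y - x).
Proof. by rewrite /rnorm distrC. Qed.

Lemma ler_rnormD x y : rnorm (x + y) <= rnorm x + rnorm y.
Proof. by rewrite -lecR rmorphD /= !rnormE ler_normD. Qed.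

Lemma ler_rnormB x y : rnorm (x - y) <= rnorm x + rnorm y.
Proof. by rewrite -[rnorm y]rnormN ler_rnormD. Qed.

Lemma rnormZ (a : R[i]) x : rnorm (a *: x) = complex.Re `|a| * rnorm x.
Proof.
rewrite {1}/rnorm normrZ -rnormE.
by case: (`|a|) => p q /=; rewrite mulr0 subr0.
Qed.

Lemma rnormZr (a : R) x : 0 <= a -> rnorm (a%:C *: x) = a * rnorm x.
Proof. by move=> a0; rewrite rnormZ ger0_norm // ler0c. Qed.

Lemma rnorm_cvgP (u : nat -> X) x :
  u @ \oo --> x <->
  forall e : R, 0 < e -> exists N, forall n, (N <= n)%N -> rnorm (x - u n) < e.
Proof.
split=> [/cvgrPdist_lt cu e e0|cu].
  have /cu [N _ uN] : 0 < e%:C :> R[i] by rewrite ltcR.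
  by exists N => n /uN /=; rewrite -rnormE ltcR.
apply/cvgrPdist_lt => e e0.
have eE : e = (complex.Re e)%:C by rewrite RRe_real // gtr0_real.
have [|N uN] := cu (complex.Re e); first by rewrite -ltcR -eE.
by exists N => // n /uN; rewrite -ltcR -eE rnormE.
Qed.

End RealNorm.

Lemma rnorm_cauchy_cvg (R : realType) (X : completeNormedModType R[i])
    (u : nat -> X) :
  (forall e : R, 0 < e -> exists N, forall m n, (N <= m)%N -> (N <= n)%N ->
     rnorm (u m - u n) < e) ->
  exists x : X, u @ \oo --> x.
Proof.
move=> cu; suff /cauchy_cvg cv : cauchy (u @ \oo).
  by exists (lim (u @ \oo)).
apply: cauchy_exP => e e0.
have eE : e = (complex.Re e)%:C by rewrite RRe_real // gtr0_real.
have [|N uN] := cu (complex.Re e); first by rewrite -ltcR -eE.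
exists (u N); exists N => // n Nn.
by rewrite -ball_normE /ball_ /= -rnormE eE ltcR; exact: uN.
Qed.

(** * Geometry of the inner product *)

Section RealInner.
Variables (R : realType) (X : normedModType R[i]) (dot : {dot X for Num.conj}).
Hypothesis norm_dot : forall x : X, `|x| ^+ 2 = dot x x.
Implicit Types x y : X.

Lemma dot_conj x y : dot x y = (dot y x)^*.
Proof. by rewrite hermC expr0 mul1r. Qed.

Lemma dot_rnorm x : dot x x = (rnorm x ^+ 2)%:C.
Proof. by rewrite -norm_dot -rnormE rmorphXn. Qed.

Lemma rnormD_sqr x y :
  rnorm (x + y) ^+ 2 = rnorm x ^+ 2 + rnorm y ^+ 2 + 2 * complex.Re (dot x y).
Proof.
apply: complexI; rewrite -dot_rnorm linearDl !linearDr /= (dot_conj y x).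
rewrite !dot_rnorm; case: (dot x y) => a b /=; simpc.
by congr (_ +i* _); ring.
Qed.

Lemma rnormB_sqr x y :
  rnorm (x - y) ^+ 2 = rnorm x ^+ 2 + rnorm y ^+ 2 - 2 * complex.Re (dot x y).
Proof.
rewrite rnormD_sqr rnormN linearNr.
by rewrite raddfN /= mulrN.
Qed.

Lemma parallelogram x y :
  rnorm (x - y) ^+ 2 = 2 * rnorm x ^+ 2 + 2 * rnorm y ^+ 2 - rnorm (x + y) ^+ 2.
Proof. rewrite rnormB_sqr rnormD_sqr; lra. Qed.

(** Along a = s <q, l> with s > 0 the squared distance changes by
    |<q, l>|^2 (s^2 |l|^2 - 2 s), which is negative for small s unless
    <q, l> = 0. *)
Lemma minimal_orthogonal q l :
  (forall a : R[i], rnorm q <= rnorm (q - a *: l)) -> dot l q = 0.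
Proof.
move=> qmin; rewrite dot_conj; apply/eqP; rewrite conjc_eq0; apply/eqP.
set z := dot q l.
(* Any positive s with s |l|^2 < 2 would do. *)
pose s : R := (rnorm l ^+ 2 + 1)^-1.
have l1 : 0 < rnorm l ^+ 2 + 1 by rewrite ltr_wpDl ?sqr_ge0.
have s0 : 0 < s by rewrite invr_gt0.
have := qmin (s%:C * z).
rewrite -ler_sqr ?nnegrE ?rnorm_ge0 // rnormB_sqr rnormZ linearZr_LR /= -/z.
pose n2 := complex.Re z ^+ 2 + complex.Im z ^+ 2.
rewrite exprMn sqr_Re_normMr Re_conjMr -/n2 => ineq.
have sl : s * rnorm l ^+ 2 <= 1.
  by rewrite /s mulrC ler_pdivrMr // mul1r lerDl.
have n20 : 0 <= n2 by rewrite addr_ge0 ?sqr_ge0.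
have : s * n2 <= 0.
  have : (s * rnorm l ^+ 2) * (s * n2) <= 1 * (s * n2).
    by rewrite ler_wpM2r // mulr_ge0 // ltW.
  move: ineq; lra.
rewrite pmulr_rle0 // => n2le.
have : n2 == 0 by rewrite eq_le n2le n20.
rewrite paddr_eq0 ?sqr_ge0 // !sqrf_eq0 => /andP[/eqP re0 /eqP im0].
by apply/eqP; rewrite eq_complex re0 im0 !eqxx.
Qed.

(** If z is orthogonal to x then |z - x|^2 = |z|^2 + |x|^2 >= |z|^2, so the ball
    of radius |z| around z misses D; by density its radius is zero. *)
Lemma dense_orthogonal (D : set X) z :
  dense D -> (forall x, D x -> dot x z = 0) -> z = 0.
Proof.
move=> dD Dz; apply: contrapT => z0.
have nz : 0 < rnorm z.
  rewrite lt_neqAle rnorm_ge0 andbT eq_sym; apply/eqP => /rnorm0_eq0; exact: z0.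
have nzC : 0 < (rnorm z)%:C :> R[i] by rewrite ltcR.
have [||x [bx Dx]] := dD (ball z (rnorm z)%:C).
- by exists z; exact: ballxx.
- exact: ball_open.
move: bx; rewrite -ball_normE /ball_ /= -rnormE ltcR rnorm_distC.
rewrite ltNge => /negP; apply.
rewrite -ler_sqr ?nnegrE ?rnorm_ge0 // rnormB_sqr Dz //= mulr0 subr0.
by rewrite lerDr sqr_ge0.
Qed.

End RealInner.

(** * Linear and closed operators *)

Section LinearOperator.
Variables (K : pzRingType) (V W : lmodType K) (T : operator V W).
Hypothesis linT : is_linear T.

Lemma op_dom0 : dom T 0.
Proof. by case: linT. Qed.

Lemma op_domP a x y : dom T x -> dom T y -> dom T (a *: x + y).
Proof. by case: linT => _ + _; apply. Qed.

Lemma op_linear a x y : dom T x -> dom T y -> T (a *: x + y) = a *: T x + T y.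
Proof. by case: linT => _ _; apply. Qed.

Lemma op0 : T 0 = 0.
Proof.
have := op_linear (- 1) op_dom0 op_dom0.
by rewrite scaler0 addr0 scaleN1r addNr.
Qed.

Lemma op_domZ a x : dom T x -> dom T (a *: x).
Proof.
by move=> Tx; rewrite -[_ *: _]addr0; apply: op_domP => //; exact: op_dom0.
Qed.

Lemma op_domD x y : dom T x -> dom T y -> dom T (x + y).
Proof. by move=> Tx; rewrite -[x]scale1r; exact: op_domP. Qed.

Lemma op_domB x y : dom T x -> dom T y -> dom T (x - y).
Proof. by move=> Tx Ty; rewrite addrC -scaleN1r; exact: op_domP. Qed.

Lemma opZ a x : dom T x -> T (a *: x) = a *: T x.
Proof.
move=> Tx; rewrite -[a *: x]addr0 op_linear ?op0 ?addr0 //; exact: op_dom0.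
Qed.

Lemma opD x y : dom T x -> dom T y -> T (x + y) = T x + T y.
Proof. by move=> Tx Ty; rewrite -{1}[x]scale1r op_linear // scale1r. Qed.

Lemma opB x y : dom T x -> dom T y -> T (x - y) = T x - T y.
Proof.
by move=> Tx Ty; rewrite addrC -scaleN1r op_linear // scaleN1r addrC.
Qed.

End LinearOperator.

Lemma closed_op_cvg (R : numFieldType) (V W : normedModType R)
    (T : operator V W) (u : nat -> V) (x : V) (z : W) :
  closed_op T -> (forall n, dom T (u n)) ->
  u @ \oo --> x -> T \o u @ \oo --> z -> dom T x /\ T x = z.
Proof.
move=> clT Du ux Tuz.
have cvp : (fun n => (u n, T (u n))) @ \oo --> (x, z).
  exact: (cvg_pair ux Tuz).
have [|//] := closed_cvg _ clT _ _ cvp.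
by exists 0%N => // n _ /=; split.
Qed.

Section Onto.
Variables (R : realType) (X : completeNormedModType R[i]).
Variable dot : {dot X for Num.conj}.
Hypothesis norm_dot : forall x : X, `|x| ^+ 2 = dot x x.

Lemma lipschitz_continuous (K : X -> X) (k : R) :
  (forall x y, rnorm (K x - K y) <= k * rnorm (x - y)) -> continuous K.
Proof.
move=> Kk x; apply/cvgrPdist_lt => e e0.
have eE : e = (complex.Re e)%:C by rewrite RRe_real // gtr0_real.
have re0 : 0 < complex.Re e by rewrite -ltcR -eE.
pose r := complex.Re e / (`|k| + 1).
have k1 : 0 < `|k| + 1 by rewrite ltr_wpDl.
have r0 : 0 < r%:C by rewrite ltcR divr_gt0.
near=> y.
have : ball x r%:C y by near: y; exact: nbhsx_ballx.
rewrite -ball_normE /ball_ /= -!rnormE eE !ltcR /r ltr_pdivlMr // => xy.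
have := Kk x y; have := rnorm_ge0 (x - y); have := ler_norm k.
nra.
Unshelve. all: by end_near. Qed.

Lemma continuous_closed_op (K : X -> X) :
  continuous K -> closed_op (Operator setT K).
Proof.
move=> cK; rewrite /closed_op.
have -> : [set p : X * X | dom (Operator setT K) p.1 /\ p.2 = K p.1] =
    (fun p : X * X => p.2 - K p.1) @^-1` [set 0].
  apply/seteqP; split=> -[x y] /= => [[_ ->]|/eqP]; first by rewrite subrr.
  by rewrite subr_eq0 => /eqP.
apply: preimage_closed => [[x y] _|]; last first.
  exact/accessible_closed_set1/hausdorff_accessible/norm_hausdorff.
have cvK : K \o fst @ (x, y) --> K x.
  apply: (@cvg_comp _ _ _ fst K (nbhs (x, y)) (nbhs x)); last exact: cK.
  exact: cvg_fst.
by apply: cvgB cvK; exact: cvg_snd.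
Qed.

(** Uniform convexity: if a and b nearly realise the distance d from w while
    their midpoint is at distance at least d, the parallelogram law makes a and
    b close.  This makes minimising sequences Cauchy. *)
Lemma midpoint_dist (w a b : X) (d delta : R) :
  0 <= d ->
  d <= rnorm (w - (2^-1 *: a + 2^-1 *: b)) ->
  rnorm (w - a) < d + delta -> rnorm (w - b) < d + delta ->
  rnorm (a - b) ^+ 2 <= 8 * d * delta + 4 * delta ^+ 2.
Proof.
move=> d0 dmid wa wb.
have -> : a - b = (w - b) - (w - a) by rewrite opprB [RHS]addrC addrA subrK.
rewrite (parallelogram norm_dot).
have -> : w - b + (w - a) = 2%:C *: (w - (2^-1 *: a + 2^-1 *: b)).
  have -> : 2%:C = 2 :> R[i] by rewrite rmorph_nat.
  rewrite scalerBr scalerDr !scalerA mulfV ?pnatr_eq0 // !scale1r.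
  by rewrite scaler_nat mulr2n addrACA -opprD [b + a]addrC.
rewrite rnormZr // exprMn.
have : d ^+ 2 <= rnorm (w - (2^-1 *: a + 2^-1 *: b)) ^+ 2.
  by rewrite ler_sqr ?nnegrE ?rnorm_ge0.
have : rnorm (w - a) ^+ 2 <= (d + delta) ^+ 2.
  apply: lerXn2r (ltW wa); rewrite nnegrE ?rnorm_ge0 //.
  exact: le_trans (rnorm_ge0 _) (ltW wa).
have : rnorm (w - b) ^+ 2 <= (d + delta) ^+ 2.
  apply: lerXn2r (ltW wb); rewrite nnegrE ?rnorm_ge0 //.
  exact: le_trans (rnorm_ge0 _) (ltW wb).
nra.
Qed.

(** The distance from w to the range of T is attained: the images of a
    minimising sequence are Cauchy, hence so is the sequence since T is bounded
    below, and closedness puts the limit in the graph.  The residual w - T x is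
    then orthogonal to the range, hence zero. *)
Lemma closed_op_onto (T : operator X X) (c : R) :
  is_linear T -> closed_op T -> 0 < c ->
  (forall x, dom T x -> c * rnorm x <= rnorm (T x)) ->
  (forall q, (forall x, dom T x -> dot (T x) q = 0) -> q = 0) ->
  forall w, exists2 x, dom T x & T x = w.
Proof.
move=> linT clT c0 Tc Torth w.
pose E := [set rnorm (w - T x) | x in dom T].
have Elb : lbound E 0 by move=> _ [x _ <-]; exact: rnorm_ge0.
have Einf : has_inf E.
  by split; [exists (rnorm (w - T 0)), 0 => //; exact: op_dom0 | exists 0].
pose d := inf E.
have d0 : 0 <= d by apply: lb_le_inf => //; case: Einf.
have dmin x : dom T x -> d <= rnorm (w - T x).
  by move=> Tx; apply: ge_inf; [exists 0|exists x].
have /choice[u uP] (n : nat) :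
    exists x, dom T x /\ rnorm (w - T x) < d + n.+1%:R^-1.
  have n0 : 0 < n.+1%:R^-1 :> R by rewrite invr_gt0.
  have [_ [x Tx <-] xd] := inf_adherent n0 Einf.
  by exists x.
have Du n : dom T (u n) by case: (uP n).
have nearu (e : R) : 0 < e ->
    exists N, forall n, (N <= n)%N -> rnorm (w - T (u n)) < d + e.
  move=> e0; have [N _ Ne] := near_infty_natSinv_lt (PosNum e0).
  exists N => n /Ne /= ne; case: (uP n) => _ /lt_trans; apply.
  by rewrite ltrD2l.
have Tu_cauchy (e : R) : 0 < e ->
    exists N, forall m n, (N <= m)%N -> (N <= n)%N ->
    rnorm (T (u m) - T (u n)) < e.
  move=> e0.
  (* [delta] makes the bound of [midpoint_dist] smaller than e ^+ 2; it is at
     most 1, so that 4 * delta ^+ 2 <= 4 * delta. *)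
  pose D := 8 * d + 4 + e ^+ 2.
  have D0 : 0 < D by rewrite /D; nra.
  pose delta := e ^+ 2 / (2 * D).
  have delta0 : 0 < delta by rewrite divr_gt0 ?mulr_gt0 ?exprn_gt0.
  have deltaD : 2 * delta * D = e ^+ 2.
    by rewrite /delta; field; exact: lt0r_neq0.
  have [N uN] := nearu delta delta0.
  exists N => m n /uN um /uN un.
  rewrite -ltr_sqr ?nnegrE ?rnorm_ge0 ?(ltW e0) //.
  apply: le_lt_trans (midpoint_dist d0 _ um un) _.
    rewrite -!(opZ linT) // -(opD linT); try exact: op_domZ.
    by apply: dmin; apply: op_domD => //; exact: op_domZ.
  have : delta <= 1.
    rewrite /delta ler_pdivrMr ?mulr_gt0 // mul1r /D; nra.
  move: deltaD; rewrite /D; nra.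
have [z Tuz] := rnorm_cauchy_cvg Tu_cauchy.
have [|x ux] := @rnorm_cauchy_cvg _ _ u.
  move=> e e0; have [|N uN] := Tu_cauchy (c * e); first by rewrite mulr_gt0.
  exists N => m n Nm Nn; rewrite -(ltr_pM2l c0).
  apply: le_lt_trans (uN m n Nm Nn).
  by rewrite -(opB linT) //; apply: Tc; exact: op_domB.
have [Tx Txz] := closed_op_cvg clT Du ux Tuz.
exists x => //; apply/eqP; rewrite eq_sym -subr_eq0; apply/eqP.
have wzd : rnorm (w - T x) <= d.
  apply/ler_addgt0Pr => e e0.
  have e20 : 0 < e / 2 by rewrite divr_gt0.
  have [N1 uN1] := nearu _ e20.
  have [N2 uN2] := (rnorm_cvgP _ _).1 Tuz _ e20.
  set n := maxn N1 N2.
  have h1 := uN1 n (leq_maxl _ _); have h2 := uN2 n (leq_maxr _ _).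
  have -> : w - T x = (w - T (u n)) - (T x - T (u n)).
    by rewrite opprB addrA subrK.
  rewrite -Txz /= in h2.
  apply: le_trans (ler_rnormB _ _) _; lra.
apply: Torth => y Ty; apply: (minimal_orthogonal norm_dot) => a.
apply: le_trans wzd _.
rewrite -addrA -opprD [T x + _]addrC -(op_linear linT) //; apply: dmin.
exact: op_domP.
Qed.

End Onto.

(** * Adjoints *)

Section ProductDot.
Variables (C : numClosedFieldType) (V : lmodType C).
Variable dot : {dot V for Num.conj}.

Let dotP := dot_prod dot.

Let dotP_linearl u : GRing.linear_for *%R (dotP^~ u).
Proof.
move=> a x y; rewrite /dotP /dot_prod /= !linearDl !linearZl_LR /=.
by rewrite mulrDr addrACA.
Qed.

Let dotP_linearr u : GRing.linear_for (Num.conj \; *%R) (dotP u).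
Proof.
move=> a x y; rewrite /dotP /dot_prod /= !linearDr !linearZr_LR /=.
by rewrite addrACA -mulrDr.
Qed.

Let dotP_hermitian x y : dotP x y = (-1) ^+ false * Num.conj (dotP y x).
Proof.
rewrite expr0 mul1r /dotP /dot_prod rmorphD /=.
by rewrite !(hermC dot _ x.1) !(hermC dot _ x.2) !expr0 !mul1r !conjCK.
Qed.

Let dotP_gt0 x : x != 0 -> 0 < dotP x x.
Proof.
move=> x0; rewrite lt_neqAle addr_ge0 // andbT eq_sym paddr_eq0 // !dnorm_eq0.
by apply: contra x0; case: x => x1 x2 /= /andP[/eqP-> /eqP->].
Qed.

(** These instances bring [dot_prod] under [selfadjoint_of_onto], a statement
    about positive definite forms; the norm of the product space is the max
    norm, not the norm of [dot_prod]. *)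
HB.instance Definition _ :=
  bilinear_isBilinear.Build C (V * V)%type (V * V)%type C *%R (Num.conj \; *%R)
    (dot_prod dot) (dotP_linearl, dotP_linearr).
HB.instance Definition _ :=
  isHermitianSesquilinear.Build C (V * V)%type false Num.conj (dot_prod dot)
    dotP_hermitian.
HB.instance Definition _ :=
  isDotProduct.Build C (V * V)%type (dot_prod dot) dotP_gt0.

End ProductDot.

Section Adjoint.
Variables (K : pzRingType) (V : lmodType K) (dot : V -> V -> K).
Variable (T : operator V V).

Lemma adjointE x y : dom (adjoint dot T) y -> dom T x ->
  dot (T x) y = dot x (adjoint dot T y).
Proof. by move=> Ty Tx; apply: (xgetPex 0 Ty). Qed.

Lemma adjoint_dom y z : (forall x, dom T x -> dot (T x) y = dot x z) ->
  dom (adjoint dot T) y.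
Proof. by move=> yz; exists z. Qed.

Hypothesis Tsa : selfadjoint dot T.

Lemma selfadjointE x y : dom T x -> dom T y -> dot (T x) y = dot x (T y).
Proof.
by case: Tsa => dT vT Tx Ty; rewrite (vT y Ty) adjointE // -dT.
Qed.

Lemma selfadjoint_dom y z :
  (forall x, dom T x -> dot (T x) y = dot x z) -> dom T y.
Proof. by move=> yz; case: Tsa => -> _; exact: adjoint_dom yz. Qed.

End Adjoint.

(** If y and z satisfy <M x, y> = <x, z> for all x, pick u with
    (M + conj a) u = z + conj a y.  By symmetry y - u is orthogonal to the range
    of M + a, so y = u lies in dom M and z = M y.  In particular z is determined
    by y, so it is the vector that [adjoint] picks. *)
Lemma selfadjoint_of_onto (C : numClosedFieldType) (V : lmodType C)
    (dot : {dot V for Num.conj}) (M : operator V V) (a : C) :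
  (forall x y, dom M x -> dom M y -> dot (M x) y = dot x (M y)) ->
  (forall w, exists2 x, dom M x & M x + a *: x = w) ->
  (forall w, exists2 x, dom M x & M x + Num.conj a *: x = w) ->
  selfadjoint dot M.
Proof.
move=> Msym Ma Mac.
have adjP y z : (forall x, dom M x -> dot (M x) y = dot x z) ->
    dom M y /\ M y = z.
  move=> yz; have [u Mu uE] := Mac (z + Num.conj a *: y).
  suff yu : y = u.
    by rewrite yu; split=> //; apply: (addIr (Num.conj a *: u)); rewrite uE yu.
  have [x Mx xE] := Ma (y - u).
  apply/eqP; rewrite -subr_eq0 -(dnorm_eq0 dot) -{1}xE linearBr subr_eq0.
  apply/eqP.
  rewrite !linearDl !linearZl_LR /= yz // Msym //.
  have : dot x (M u + Num.conj a *: u) = dot x (z + Num.conj a *: y).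
    by rewrite uE.
  by rewrite !linearDr !linearZr_LR /= conjCK => ->.
have domE : dom M = dom (adjoint dot M).
  apply/seteqP; split=> y; last by case=> z /adjP[].
  by move=> My; apply: (@adjoint_dom _ _ _ _ _ (M y)) => x Mx; exact: Msym.
split=> // y My; apply: (adjP _ _ _).2 => x Mx; apply: adjointE => //.
by rewrite -domE.
Qed.

(** * Resolvents of self-adjoint operators *)

Section Resolvent.
Variables (R : realType) (X : completeNormedModType R[i]).
Variable dot : {dot X for Num.conj}.
Hypothesis norm_dot : forall x : X, `|x| ^+ 2 = dot x x.

(** Density makes the vector z in the definition of the adjoint unique; a
    linear combination of such vectors is then the value of the adjoint. *)
Lemma adjoint_linear (T : operator X X) :
  densely_defined T -> is_linear (adjoint dot T).
Proof.
move=> dT; have adjP y z :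
    (forall x, dom T x -> dot (T x) y = dot x z) -> adjoint dot T y = z.
  move=> yz; apply/eqP; rewrite -subr_eq0; apply/eqP.
  apply: (dense_orthogonal norm_dot dT) => x Tx.
  by rewrite linearBr /= -(adjointE (ex_intro _ z yz) Tx) yz // subrr.
have lin a x y u : dom (adjoint dot T) x -> dom (adjoint dot T) y -> dom T u ->
    dot (T u) (a *: x + y) = dot u (a *: adjoint dot T x + adjoint dot T y).
  move=> Tx Ty Tu; rewrite !linearDr !linearZr_LR /=.
  by rewrite (adjointE Tx Tu) (adjointE Ty Tu).
split.
- by exists 0 => x _; rewrite !linear0r.
- by move=> a x y Tx Ty; eexists => u; exact: lin.
- by move=> a x y Tx Ty; apply: adjP => u; exact: lin.
Qed.

Definition shift_op (T : operator X X) (a : R[i]) : operator X X :=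
  Operator (dom T) (fun x => T x + a *: x).

Lemma shift_op_linear T a : is_linear T -> is_linear (shift_op T a).
Proof.
move=> linT; split=> [|b x y|b x y]; first exact: (op_dom0 linT).
- exact: (op_domP linT).
- move=> Tx Ty; rewrite /= (op_linear linT) // !scalerDr !scalerA [a * b]mulrC.
  by rewrite addrACA.
Qed.

(** The map (x, y) |-> (x, y - a x) carries the graph of T + a to that of T. *)
Lemma shift_op_closed T a : closed_op T -> closed_op (shift_op T a).
Proof.
move=> clT; rewrite /closed_op.
have -> : [set p | dom (shift_op T a) p.1 /\ p.2 = shift_op T a p.1] =
    (fun p : X * X => (p.1, p.2 - a *: p.1)) @^-1`
      [set p | dom T p.1 /\ p.2 = T p.1].
  apply/seteqP; split=> -[x y] /= [Tx yE]; split=> //.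
    by rewrite yE addrK.
  by rewrite -yE subrK.
apply: preimage_closed clT => -[x y] _.
apply: cvg_pair; first exact: cvg_fst.
have cvZ : a \*: fst @ (x, y) --> a *: x by apply: cvgZl_tmp; exact: cvg_fst.
by apply: cvgB cvZ; exact: cvg_snd.
Qed.

Lemma selfadjoint_Im_dot T x : selfadjoint dot T -> dom T x ->
  complex.Im (dot (T x) x) = 0.
Proof.
move=> saT Tx; have := congr1 (@complex.Im R) (dot_conj dot (T x) x).
rewrite -(selfadjointE saT) //; case: (dot (T x) x) => p q /= qN; lra.
Qed.

(** The cross term is twice the real part of - i t <T x, x>, and <T x, x> is
    real. *)
Lemma shift_op_rnorm T (t : R) x : selfadjoint dot T -> dom T x ->
  rnorm (shift_op T (0 +i* t) x) ^+ 2
  = rnorm (T x) ^+ 2 + t ^+ 2 * rnorm x ^+ 2.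
Proof.
move=> saT Tx; rewrite (rnormD_sqr norm_dot) rnormZ exprMn sqr_Re_norm /=.
have -> : dot (T x) ((0 +i* t) *: x) = (0 +i* t)^* * dot (T x) x.
  by rewrite linearZr_LR.
by have := selfadjoint_Im_dot saT Tx; case: (dot (T x) x) => p q /= ->; ring.
Qed.

(** The shifted operator is bounded below by |t|.  A vector q orthogonal to its
    range satisfies <T x, q> = <x, i t q>, hence q lies in dom T; then
    <T q, q> + i t |q|^2 = 0 with <T q, q> real, so q = 0. *)
Lemma selfadjoint_shift_onto T (t : R) : is_linear T -> closed_op T ->
  selfadjoint dot T -> t != 0 ->
  forall w, exists2 x, dom T x & T x + (0 +i* t) *: x = w.
Proof.
move=> linT clT saT t0.
have normT x := shift_op_rnorm t saT (x := x).
apply: (@closed_op_onto _ _ _ norm_dot (shift_op T (0 +i* t)) `|t|).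
- exact: shift_op_linear.
- exact: shift_op_closed.
- by rewrite normr_gt0.
- move=> x Tx; rewrite -ler_sqr ?nnegrE ?mulr_ge0 ?rnorm_ge0 //.
  by rewrite normT // exprMn real_normK ?num_real // lerDr sqr_ge0.
- move=> q qT; have Tq : dom T q.
    apply: (@selfadjoint_dom _ _ _ _ saT q ((0 +i* t) *: q)) => x Tx.
    have := qT x Tx; rewrite /= linearDl linearZl_LR /= linearZr_LR /=.
    move/eqP; rewrite addr_eq0 => /eqP ->; rewrite -mulNr; congr (_ * _).
    by simpc.
  have := qT q Tq; rewrite /= linearDl linearZl_LR /= (dot_rnorm norm_dot).
  have := selfadjoint_Im_dot saT Tq; case: (dot (T q) q) => p r /= -> [_].
  move=> /eqP; rewrite mul0r !add0r mulf_eq0 (negPf t0) /= sqrf_eq0.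
  by move=> /eqP /rnorm0_eq0.
Qed.

End Resolvent.

(** * Perturbation of the diagonal part *)

Section Perturbation.
Variables (R : realType) (X : completeNormedModType R[i]).
Variable dot : {dot X for Num.conj}.
Hypothesis norm_dot : forall x : X, `|x| ^+ 2 = dot x x.

(** Here 1 + K is bounded below by 1 - k, and if q is orthogonal to its range
    then <q + K q, q> = 0, so that |K q| >= |q|, which forces q = 0. *)
Lemma contraction_shift_onto (K : X -> X) (k : R) :
  (forall a x y, K (a *: x + y) = a *: K x + K y) ->
  (forall x, rnorm (K x) <= k * rnorm x) -> k < 1 ->
  forall w, exists v, v + K v = w.
Proof.
move=> linK Kk k1 w.
have linT : is_linear (Operator setT (fun v => v + K v)).
  by split=> // a x y _ _; rewrite /= linK scalerDr addrACA.
have KB x y : K (x - y) = K x - K y.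
  by rewrite addrC -scaleN1r linK scaleN1r addrC.
have cT : continuous (fun v => v + K v).
  apply: (@lipschitz_continuous _ _ _ (1 + k)) => x y.
  rewrite opprD addrACA -KB mulrDl mul1r.
  by apply: le_trans (ler_rnormD _ _) _; rewrite lerD2l.
have [||q qK|v _ <-] := closed_op_onto norm_dot (c := 1 - k) linT
    (continuous_closed_op cT) _ _ _ w; last by exists v.
- by rewrite subr_gt0.
- move=> x _ /=; have := ler_rnormB (x + K x) (K x); rewrite addrK.
  by have := Kk x; lra.
have qK_le : rnorm q <= rnorm (K q).
  rewrite -ler_sqr ?nnegrE ?rnorm_ge0 //.
  rewrite -[in leRHS](addKr q (K q)) [- q + _]addrC.
  by rewrite (rnormB_sqr norm_dot) qK //= mulr0 subr0 lerDr sqr_ge0.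
apply: rnorm0_eq0; apply/eqP; rewrite eq_le rnorm_ge0 andbT.
have k1' : 0 < 1 - k by rewrite subr_gt0.
rewrite -(pmulr_rle0 _ k1'); have := Kk q; lra.
Qed.

Lemma selfadjoint_resolvent (T : operator X X) (t : R) :
  is_linear T -> closed_op T -> selfadjoint dot T -> t != 0 ->
  exists Rs : X -> X,
    [/\ forall a v w, Rs (a *: v + w) = a *: Rs v + Rs w,
        forall w, dom T (Rs w) & forall w, T (Rs w) + (0 +i* t) *: Rs w = w].
Proof.
move=> linT clT saT t0.
have /choice[Rs RsE] w : exists x, dom T x /\ T x + (0 +i* t) *: x = w.
  have [x ? ?] := selfadjoint_shift_onto norm_dot linT clT saT t0 w.
  by exists x.
exists Rs; split=> [a v w|w|w]; [|by case: (RsE w)..].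
have dR u : dom T (Rs u) by case: (RsE u).
have R_E u : shift_op T (0 +i* t) (Rs u) = u by case: (RsE u).
have linS := shift_op_linear (0 +i* t) linT.
apply/eqP; rewrite -subr_eq0; apply/eqP/rnorm0_eq0/eqP.
set d := _ - _.
have dd : dom T d.
  by apply: (op_domB linT) => //; exact: (op_domP linT).
have := shift_op_rnorm norm_dot t saT dd.
have -> : shift_op T (0 +i* t) d = 0.
  rewrite /d (opB linS); [|exact: dR|exact: (op_domP linT)].
  by rewrite (op_linear linS) ?R_E ?subrr //; exact: dR.
rewrite rnorm0 expr0n -exprMn /= => /eqP; rewrite eq_sym paddr_eq0 ?sqr_ge0 //.
by move=> /andP[_]; rewrite sqrf_eq0 mulf_eq0 (negPf t0).
Qed.

(** The relative bound is an infimum that need not be attained, so the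
    constant [a] is taken from below an arbitrary number strictly above it. *)
Lemma rel_bound_lt (S T : operator X X) (r : R) :
  rel_bounded S T -> rel_bound S T < r ->
  exists a b, [/\ 0 <= a < r, 0 <= b &
    forall x, dom T x -> rnorm (S x) <= a * rnorm (T x) + b * rnorm x].
Proof.
move=> [_ [a [b ab]]] ltr.
have [|a' [b' [a'0 b'0 abP]] a'r] := inf_lt _ ltr; first by exists a, b.
exists a', b'; rewrite a'0 a'r; split=> // x Tx.
by rewrite -lecR rmorphD !rmorphM /= !rnormE; exact: abP.
Qed.

(** Since |T x| and |t| |x| are both at most |(T + i t) x|, a large |t| absorbs
    the term b |x| into the margin a' - a: thus |S (T + i t)^-1| <= a'. *)
Lemma rel_bound_resolvent (S T : operator X X) (a a' b t : R) (x : X) :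
  selfadjoint dot T -> dom T x -> 0 <= a -> b <= (a' - a) * `|t| -> a <= a' ->
  rnorm (S x) <= a * rnorm (T x) + b * rnorm x ->
  rnorm (S x) <= a' * rnorm (T x + (0 +i* t) *: x).
Proof.
move=> saT Tx a0 bt aa' /le_trans; apply.
have := shift_op_rnorm norm_dot t saT Tx; rewrite /=.
set s := rnorm (T x + _); set u := rnorm (T x); set v := rnorm x => suv.
have s0 : 0 <= s by exact: rnorm_ge0.
have u0 : 0 <= u by exact: rnorm_ge0.
have v0 : 0 <= v by exact: rnorm_ge0.
have us : u <= s.
  by rewrite -ler_sqr ?nnegrE // suv lerDl mulr_ge0 ?sqr_ge0.
have vs : `|t| * v <= s.
  rewrite -ler_sqr ?nnegrE ?mulr_ge0 // suv exprMn real_normK ?num_real //.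
  by rewrite lerDr sqr_ge0.
have h1 : b * v <= (a' - a) * `|t| * v by rewrite ler_wpM2r.
have h2 : (a' - a) * (`|t| * v) <= (a' - a) * s by rewrite ler_wpM2l ?subr_ge0.
have h3 : a * u <= a * s by rewrite ler_wpM2l.
rewrite -mulrA in h1; lra.
Qed.

(** Put v := (C + i t) x, P := A (C + i t)^-1 and Q := A' (B - i t)^-1.  The
    second equation gives (B - i t) y = - (w2 + P v), and the first becomes
    v + Q P v = w1 - Q w2, where Q P has norm at most c1 * c2 < 1. *)
Lemma block_shift_onto (A A' B C : operator X X) (t a1 b1 a2 b2 c1 c2 : R) :
  is_linear A -> is_linear A' -> is_linear B -> is_linear C ->
  closed_op B -> closed_op C -> selfadjoint dot B -> selfadjoint dot C ->
  dom C `<=` dom A -> dom B `<=` dom A' ->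
  (forall x, dom C x -> rnorm (A x) <= a1 * rnorm (C x) + b1 * rnorm x) ->
  (forall y, dom B y -> rnorm (A' y) <= a2 * rnorm (B y) + b2 * rnorm y) ->
  0 <= a1 <= c1 -> 0 <= a2 <= c2 -> c1 * c2 < 1 -> t != 0 ->
  b1 <= (c1 - a1) * `|t| -> b2 <= (c2 - a2) * `|t| ->
  forall w1 w2, exists x y, [/\ dom C x, dom B y,
    C x - A' y + (0 +i* t) *: x = w1 & - (A x + B y) + (0 +i* t) *: y = w2].
Proof.
move=> linA linA' linB linC clB clC saB saC CA BA' A_C A'_B.
move=> /andP[a10 ac1] /andP[a20 ac2] c12 t0 bt1 bt2 w1 w2.
have [RC [RClin RCdom RCE]] := selfadjoint_resolvent linC clC saC t0.
have nt0 : - t != 0 by rewrite oppr_eq0.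
have [RB [RBlin RBdom RBE]] := selfadjoint_resolvent linB clB saB nt0.
rewrite -normrN in bt2.
pose P v := A (RC v); pose Q v := A' (RB v).
have Plin a v w : P (a *: v + w) = a *: P v + P w.
  by rewrite /P RClin (op_linear linA) //; exact: CA.
have Qlin a v w : Q (a *: v + w) = a *: Q v + Q w.
  by rewrite /Q RBlin (op_linear linA') //; exact: BA'.
have Pc v : rnorm (P v) <= c1 * rnorm v.
  rewrite -{2}[v]RCE; apply: (rel_bound_resolvent saC _ a10 bt1) => //.
  exact: A_C.
have Qc v : rnorm (Q v) <= c2 * rnorm v.
  rewrite -{2}[v]RBE; apply: (rel_bound_resolvent saB _ a20 bt2) => //.
  exact: A'_B.
have c20 : 0 <= c2 by exact: le_trans ac2.
have [||v vE] := @contraction_shift_onto (Q \o P) (c1 * c2) _ _ c12 (w1 - Q w2).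
- by move=> a x y /=; rewrite Plin Qlin.
- move=> x /=; apply: le_trans (Qc _) _.
  by rewrite mulrAC [leRHS]mulrC ler_wpM2l.
have QN x : Q (- x) = - Q x.
  have Q0 : Q 0 = 0.
    by have := Qlin (- 1) 0 0; rewrite scaler0 addr0 scaleN1r addNr.
  by rewrite -scaleN1r -[_ *: x]addr0 Qlin Q0 addr0 scaleN1r.
have QD x y : Q (x + y) = Q x + Q y by rewrite -[x]scale1r Qlin !scale1r.
exists (RC v), (RB (- (w2 + P v))); split=> //.
- rewrite addrAC RCE -[A' _]/(Q _) QN QD opprK.
  rewrite [Q w2 + _]addrC addrA -[Q (P v)]/((Q \o P) v) vE.
  by rewrite subrK.
- have := RBE (- (w2 + P v)); set y := RB _ => yE.
  have -> : B y = - (w2 + P v) + (0 +i* t) *: y.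
    rewrite -yE -addrA -scalerDl.
    have -> : (0 +i* - t) + (0 +i* t) = 0 :> R[i] by simpc; rewrite addNr.
    by rewrite scale0r addr0.
  by rewrite -/(P v) opprD [- (- _ + _)]opprD opprK -addrA subrK addrC addrK.
Qed.

End Perturbation.

(** * Hamiltonian operator matrices *)

Section Hamiltonian.
Variables (R : realType) (X : completeNormedModType R[i]).
Variable dot : {dot X for Num.conj}.
Hypothesis norm_dot : forall x : X, `|x| ^+ 2 = dot x x.
Variables A B C : operator X X.
Let A' := adjoint dot A.
Let JH := comp_op J_op (hamiltonian_op dot A B C).

Lemma JHE p : JH p = (C p.1 - A' p.2, - (A p.1 + B p.2)).
Proof. by rewrite /= add0r addr0. Qed.

Hypothesis ham : is_hamiltonian dot A B C.
Hypothesis domH : dom (hamiltonian_op dot A B C) = dom C `*` dom B.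

Lemma dom_JH : dom JH = dom C `*` dom B.
Proof.
by rewrite -domH; apply/seteqP; split=> [p []|p Hp] //; split=> //; do !split.
Qed.

Lemma JH_symmetric p q : dom C p.1 -> dom A p.1 -> dom B p.2 -> dom A' p.2 ->
  dom C q.1 -> dom A q.1 -> dom B q.2 -> dom A' q.2 ->
  dot_prod dot (JH p) q = dot_prod dot p (JH q).
Proof.
case: ham => _ _ _ [saB saC] _ Cp Ap Bp A'p Cq Aq Bq A'q.
have A'A : dot (A' p.2) q.1 = dot p.2 (A q.1).
  by rewrite dot_conj -(adjointE A'p Aq) -dot_conj.
rewrite !JHE.
rewrite -[LHS]/(dot (C p.1 - A' p.2) q.1 + dot (- (A p.1 + B p.2)) q.2).
rewrite -[RHS]/(dot p.1 (C q.1 - A' q.2) + dot p.2 (- (A q.1 + B q.2))).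
rewrite linearBl linearBr linearNl linearNr linearDl linearDr.
have -> (a b c d : R[i]) : a - b - (c + d) = a - c - (b + d) by ring.
congr (_ - _ - (_ + _)).
- exact: (selfadjointE saC).
- exact: (adjointE A'q Ap).
- exact: A'A.
- exact: (selfadjointE saB).
Qed.

(** Both signs of the shift are handled by the same t, as only |t| enters the
    estimates. *)
Lemma JH_selfadjoint (a1 b1 a2 b2 c1 c2 : R) :
  dom C `<=` dom A -> dom B `<=` dom A' ->
  (forall x, dom C x -> rnorm (A x) <= a1 * rnorm (C x) + b1 * rnorm x) ->
  (forall y, dom B y -> rnorm (A' y) <= a2 * rnorm (B y) + b2 * rnorm y) ->
  0 <= a1 < c1 -> 0 <= a2 < c2 -> 0 <= b1 -> 0 <= b2 -> c1 * c2 < 1 ->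
  selfadjoint (dot_prod dot) JH.
Proof.
move=> CA BA' A_C A'_B /andP[a10 ac1] /andP[a20 ac2] b10 b20 c12.
case: (ham) => -[linA linB linC] [clA clB clC] [dA dB dC] [saB saC] _.
have linA' : is_linear A' by exact: adjoint_linear.
(* The two quotients are the thresholds at which each additive constant is
   absorbed; the summand 1 makes t nonzero. *)
pose t := 1 + b1 / (c1 - a1) + b2 / (c2 - a2).
have d1 : 0 < c1 - a1 by rewrite subr_gt0.
have d2 : 0 < c2 - a2 by rewrite subr_gt0.
have q1 : 0 <= b1 / (c1 - a1) by rewrite divr_ge0 // ltW.
have q2 : 0 <= b2 / (c2 - a2) by rewrite divr_ge0 // ltW.
have t0 : 0 < t by rewrite /t; lra.
have onto s : `|s| = t ->
    forall w, exists2 p, dom JH p & JH p + (0 +i* s) *: p = w.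
  move=> st [w1 w2].
  have [|||||x [y [Cx By E1 E2]]] := block_shift_onto norm_dot linA linA' linB
    linC clB clC saB saC CA BA' A_C A'_B (c1 := c1) (c2 := c2) (t := s)
    _ _ c12 _ _ _ w1 w2.
  - by rewrite a10 ltW.
  - by rewrite a20 ltW.
  - by rewrite -normr_gt0 st.
  - by rewrite st -ler_pdivrMl // mulrC /t; lra.
  - by rewrite st -ler_pdivrMl // mulrC /t; lra.
  exists (x, y); first by rewrite dom_JH.
  by rewrite JHE -E1 -E2.
pose dotXX : {dot (X * X)%type for Num.conj} := dot_prod dot.
apply: (@selfadjoint_of_onto _ _ dotXX JH (0 +i* t)).
- move=> p q; rewrite dom_JH => -[Cp Bp] [Cq Bq].
  by apply: JH_symmetric => //; do ?[exact: CA | exact: BA'].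
- by apply: onto; rewrite gtr0_norm.
- by apply: (onto (- t)); rewrite normrN gtr0_norm.
Qed.

End Hamiltonian.

(** With c1 := (r + 1) / 2 and c2 := 2 - c1 one has
    c1 * c2 = 1 - (1 - c1)^2. *)
Lemma subunit_product_gap (R : realFieldType) (r : R) : r < 1 ->
  exists c1 c2 : R, [/\ r < c1, 1 < c2 & c1 * c2 < 1].
Proof. by move=> r1; exists ((r + 1) / 2), (2 - (r + 1) / 2); split; nra. Qed.

Theorem corollary3p4 (R : realType) (X : completeNormedModType R[i])
    (dot : {dot X for Num.conj})
    (norm_dot : forall x : X, `|x| ^+ 2 = dot x x)
    (A B C : operator X X) :
  let H := hamiltonian_op dot A B C in
  let JH := comp_op J_op H in
  is_hamiltonian dot A B C ->
  dom H = dom C `*` dom B ->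
  ((rel_bounded A C /\ rel_bound A C < 1) /\
   (rel_bounded (adjoint dot A) B /\ rel_bound (adjoint dot A) B <= 1)) \/
  ((rel_bounded A C /\ rel_bound A C <= 1) /\
   (rel_bounded (adjoint dot A) B /\ rel_bound (adjoint dot A) B < 1)) ->
  op_eq JH (adjoint (dot_prod dot) JH).
Proof.
move=> H JH ham domH bounds.
have [c1 [c2 [bAC bA'B AC A'B c12]]] : exists c1 c2 : R,
    [/\ rel_bounded A C, rel_bounded (adjoint dot A) B, rel_bound A C < c1,
        rel_bound (adjoint dot A) B < c2 & c1 * c2 < 1].
  case: bounds => -[[bAC AC] [bA'B A'B]].
    have [c1 [c2 [rc1 c2_1 c12]]] := subunit_product_gap AC.
    by exists c1, c2; split=> //; exact: le_lt_trans c2_1.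
  have [c2 [c1 [rc2 c1_1 c12]]] := subunit_product_gap A'B.
  by exists c1, c2; split=> //; [exact: le_lt_trans c1_1 | rewrite mulrC].
have [a1 [b1 [a1c1 b10 A_C]]] := rel_bound_lt bAC AC.
have [a2 [b2 [a2c2 b20 A'_B]]] := rel_bound_lt bA'B A'B.
exact: (JH_selfadjoint norm_dot ham domH bAC.1 bA'B.1 A_C A'_B a1c1 a2c2).
Qed.
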